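(* Let $G$ be a finite abelian group and let $A_1,\dots,A_m$ be a bimodal collection of pairwise disjoint nonempty subsets of $G$ that partition $G$, with sizes $k_1,\dots,k_m$. If $m>1$ and $k_i>1$ for some $1\le i\le m$, then $\{A_1,\dots,A_m\}$ is not an RWEDF.
   Context: $G$ is written additively, $G^*=G\setminus\{0\}$. For $\delta\in G^*$, $N_j(\delta)=|\{(a,b): a\in A_j,\ b\in A_i \text{ for some } i\neq j,\ a-b=\delta\}|$. The collection is bimodal if $N_j(\delta)\in\{0,k_j\}$ for all $\delta\in G^*$ and all $j$. It is an RWEDF if there is a rational $\ell$ with $\sum_i \frac{1}{k_i}N_i(\delta)=\ell$ for all $\delta\in G^*$. *)

(* Defs.v *)
From HB Require Import structures.
From mathcomp Require Import all_boot all_order all_algebra.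

Set Implicit Arguments.
Unset Strict Implicit.
Unset Printing Implicit Defensive.

Import GRing.Theory.
Local Open Scope ring_scope.

Section ExternalDifferences.
Variables (G : finZmodType) (m : nat) (A : 'I_m -> {set G}).

(* N_j(delta): pairs are counted once each, even if the family overlaps. *)
Definition ext_diff_count (j : 'I_m) (delta : G) : nat :=
  #|[set p : G * G | [&& p.1 \in A j,
                         [exists i : 'I_m, (i != j) && (p.2 \in A i)] &
                         p.1 - p.2 == delta]]|.

Definition bimodal : Prop :=
  forall (j : 'I_m) (delta : G), delta != 0 ->
    ext_diff_count j delta = 0%N \/ ext_diff_count j delta = #|A j|.

Definition is_RWEDF : Prop :=
  exists l : rat, forall delta : G, delta != 0 ->
    \sum_(i < m) (#|A i|%:R)^-1 * (ext_diff_count i delta)%:R = l.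

End ExternalDifferences.

(* Main.v *)
Require Import Defs.
From mathcomp Require Import all_boot all_order all_algebra.
From mathcomp Require Import zify.

(** Bimodality makes [N_j(delta) / k_j] the indicator of [N_j(delta) != 0], so
    for an RWEDF the number [c] of indices [j] with [N_j(delta) != 0] does not
    depend on [delta != 0].  With [n = |G|], counting external differences of a
    partition gives [(n - 1) c = \sum_j (n - k_j) = m n - n].  As [c <= m], either
    [c < m] and [n (m - 1) <= (n - 1) (m - 1)] is absurd, or [c = m] and [n = m]
    contradicts [n = \sum_j k_j > m]. *)

Set Implicit Arguments.
Unset Strict Implicit.
Unset Printing Implicit Defensive.

Import GRing.Theory Num.Theory.

Section Partition.
Variables (G : finZmodType) (m : nat) (A : 'I_m -> {set G}).
Hypothesis A_disjoint : forall i j : 'I_m, i != j -> [disjoint A i & A j].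
Hypothesis A_cover : \bigcup_(i < m) A i = [set: G].

Lemma in_other_block (j : 'I_m) (x : G) :
  [exists i : 'I_m, (i != j) && (x \in A i)] = (x \notin A j).
Proof.
apply/existsP/idP => [[i /andP[ij xi]]|xj].
  by rewrite (disjointFr (A_disjoint ij) xi).
have : x \in \bigcup_(i < m) A i by rewrite A_cover inE.
case/bigcupP => i _ xi; exists i; rewrite xi andbT.
by apply: contraNneq xj => <-.
Qed.

Lemma ext_diff_countE (j : 'I_m) (delta : G) :
  ext_diff_count A j delta =
  #|[set p in setX (A j) (~: A j) | (p.1 - p.2)%R == delta]|.
Proof.
by apply: eq_card => p; rewrite !inE in_other_block andbA.
Qed.

(** Lets the sums below run over all of [G] rather than over nonzero [delta] only. *)
Lemma ext_diff_count0 (j : 'I_m) : ext_diff_count A j 0%R = 0.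
Proof.
rewrite ext_diff_countE; apply/eqP; rewrite cards_eq0; apply/eqP/setP => -[x y].
rewrite !inE /= subr_eq0; apply/negP => /andP[/andP[xj yj] /eqP xy].
by rewrite -xy xj in yj.
Qed.

(** Each pair in [A j] times its complement has exactly one difference. *)
Lemma sum_ext_diff_count (j : 'I_m) :
  \sum_(delta : G) ext_diff_count A j delta = #|A j| * (#|G| - #|A j|).
Proof.
rewrite -[A j in X in _ * X]setCK -cardsCs -cardsX -sum1_card.
rewrite (partition_big (fun p : G * G => (p.1 - p.2)%R) xpredT) //=.
apply: eq_bigr => delta _; rewrite ext_diff_countE -sum1_card.
by apply: eq_bigl => p; rewrite !inE.
Qed.

Lemma sum_card_blocks : \sum_(i < m) #|A i| = #|G|.
Proof.
rewrite -cardsT -A_cover -sum1_card.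
rewrite (eq_bigr (fun i => \sum_(x in A i) 1)) => [|i _]; last by rewrite sum1_card.
by rewrite partition_disjoint_bigcup.
Qed.

End Partition.

Theorem mainTheorem17 (G : finZmodType) (m : nat) (A : 'I_m -> {set G})
    (A_nonempty : forall i : 'I_m, A i != set0)
    (A_disjoint : forall i j : 'I_m, i != j -> [disjoint A i & A j])
    (A_cover : \bigcup_(i < m) A i = [set: G])
    (A_bimodal : bimodal A)
    (m_gt1 : 1 < m)
    (k_gt1 : exists i : 'I_m, 1 < #|A i|) :
  ~ is_RWEDF A.
Proof.
case=> l l_const.
have k_gt0 i : 0 < #|A i| by rewrite card_gt0.
have sumk := sum_card_blocks A_disjoint A_cover.
pose b i delta : nat := ext_diff_count A i delta != 0.
(* Bimodality says nothing at [delta = 0]; there both sides vanish. *)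
have count_b i delta : ext_diff_count A i delta = #|A i| * b i delta.
  have [->|d0] := eqVneq delta 0%R.
    by rewrite /b ext_diff_count0 ?muln0.
  rewrite /b; case: (A_bimodal i delta d0) => ->; first by rewrite muln0.
  by rewrite -lt0n k_gt0 muln1.
have sum_b i : \sum_delta b i delta = #|G| - #|A i|.
  apply/eqP; rewrite -(eqn_pmul2l (k_gt0 i)) big_distrr /=.
  rewrite -(sum_ext_diff_count A_disjoint A_cover i).
  by apply/eqP/eq_bigr => delta _.
pose c delta := \sum_(i < m) b i delta.
have c_l delta : delta != 0%R -> ((c delta)%:R)%R = l.
  move=> d0; rewrite -(l_const delta d0) natr_sum; apply: eq_bigr => i _.
  by rewrite count_b natrM mulKf // pnatr_eq0 -lt0n.
(* The block [i0] has at least two elements and every other block at least one. *)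
have m_lt_n : m < #|G|.
  have [i0 ki0] := k_gt1; rewrite -sumk -[X in X < _]card_ord -sum1_card.
  rewrite (bigD1 i0) //= [X in _ < X](bigD1 i0) //= -addSn leq_add //.
  by apply: leq_sum => i _.
have [d d0] : exists d : G, d != 0%R.
  apply/existsP; rewrite -negb_forall; apply/negP => /forallP G0.
  have : #|G| <= 1 by apply/card_le1_eqP => x y _ _; rewrite (eqP (G0 x)) (eqP (G0 y)).
  lia.
have c_le : c d <= m.
  rewrite -[X in _ <= X]card_ord -sum1_card.
  by apply: leq_sum => i _; rewrite leq_b1.
(* The double count, with [#|G|] moved to the left to avoid truncated subtraction. *)
have total : (#|G|.-1 * c d + #|G| = m * #|G|)%N.
  have -> : #|G|.-1 * c d = \sum_(i < m) (#|G| - #|A i|).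
    under [RHS]eq_bigr => i _ do rewrite -sum_b.
    (* After the exchange, [delta = 0] contributes nothing and each of the [#|G|.-1] other elements
       contributes [c d]. *)
    rewrite exchange_big /= (bigD1 0%R) //= big1 ?add0n => [|i _]; last first.
      by rewrite /b ext_diff_count0.
    rewrite -(cardC1 (0%R : G)) -sum_nat_const; apply: eq_bigr => e e0.
    (* [c e] and [c d] agree as naturals because both become [l] in [rat]. *)
    by apply/eqP; rewrite -(eqr_nat rat) -/(c e) !c_l.
  rewrite -[X in _ + X]sumk -big_split /= -[in RHS](card_ord m) -sum_nat_const.
  by apply: eq_bigr => i _; rewrite subnK // max_card.
have [c_lt|c_ge] := ltnP (c d) m; last first.
  have cm : c d = m by lia.
  rewrite cm in total; nia.
have : #|G|.-1 * c d <= #|G|.-1 * m.-1 by apply: leq_mul => //; lia.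
nia.
Qed.
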